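(* For each $X\in\{\ell_\infty,c,c_0\}$, the spaces $X(\Omega)$ and $X(\Gamma)$, with the norms $\|x\|_{X(\Omega)}=\|\Omega x\|_{\ell_\infty}$ and $\|x\|_{X(\Gamma)}=\|\Gamma x\|_{\ell_\infty}$ respectively, are norm isomorphic to $X$ (with the supremum norm); that is, there are surjective linear isometries $X(\Omega)\to X$ and $X(\Gamma)\to X$.
   Context: $\omega$ is the space of all real (or complex) sequences $x=(x_k)_{k\ge1}$; $\ell_\infty$, $c$, $c_0$ are the spaces of bounded, convergent and null sequences, with the norm $\|x\|_{\ell_\infty}=\sup_k|x_k|$. The infinite matrix $\Omega=(a_{nk})_{n,k\ge1}$ is defined by $a_{nk}=k$ for $1\le k\le n$ and $a_{nk}=0$ for $k>n$; the infinite matrix $\Gamma=(b_{nk})_{n,k\ge1}$ is defined by $b_{nk}=1/k$ for $1\le k\le n$ and $b_{nk}=0$ for $k>n$. Thus $(\Omega x)_n=\sum_{k=1}^n kx_k$ and $(\Gamma x)_n=\sum_{k=1}^n k^{-1}x_k$. For $X\in\{\ell_\infty,c,c_0\}$, $X(\Omega)=\{x\in\omega:\Omega x\in X\}$ and $X(\Gamma)=\{x\in\omega:\Gamma x\in X\}$. *)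

(* Defs.v *)
From HB Require Import structures.
From mathcomp Require Import all_boot all_order all_algebra.
From mathcomp Require Import complex.
From mathcomp Require Import all_classical all_reals all_analysis.

Set Implicit Arguments.
Unset Strict Implicit.
Unset Printing Implicit Defensive.

Import Order.TTheory GRing.Theory Num.Theory.
Import numFieldNormedType.Exports.

Local Open Scope classical_set_scope.
Local Open Scope complex_scope.
Local Open Scope ring_scope.

(* A sequence (x_k)_{k >= 1} is an [x : nat -> K] with [x k] standing for
   x_{k+1}; the entries of infinite matrices are shifted in the same way. *)

Variant scalar_field (R : realType) : numFieldType -> Prop :=
  | real_scalars : scalar_field R R
  | complex_scalars : scalar_field R R[i].

Variant classical_space := ell_infty | conv | null.

Section SequenceSpaces.
Variable K : numFieldType.

Definition seq_space (X : classical_space) : set (nat -> K) :=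
  match X with
  | ell_infty => [set x | bounded_fun x]
  | conv => [set x | cvgn x]
  | null => [set x | x @ \oo --> (0 : K)]
  end.

(* The norm is K-valued, as in [normedModType K]. On R[i] the order is partial
   (u <= v iff Im u = Im v and Re u <= Re v); the supremum of a nonempty set of
   nonnegative elements that is bounded above is the usual real supremum. *)
Definition sup_norm (x : nat -> K) : K :=
  supremum 0 (range (fun k => `|x k|)).

Definition transform (A : nat -> nat -> K) (x : nat -> K) : nat -> K :=
  fun n => limn (series (fun k => A n k * x k)).

(* For a lower triangular A every series defining [transform A x] has finitely
   many nonzero terms, so X(A) needs no convergence condition on x. *)
Record triangle := Triangle {
  entry :> nat -> nat -> K;
  entry_eq0 : forall n k, (n < k)%N -> entry n k = 0 }.

Definition seq_domain (X : classical_space) (A : triangle) : set (nat -> K) :=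
  [set x | seq_space X (transform A x)].

Definition Omega_entry (n k : nat) : K := if (k <= n)%N then k.+1%:R else 0.

Definition Gamma_entry (n k : nat) : K := if (k <= n)%N then k.+1%:R^-1 else 0.

Lemma Omega_entry_eq0 n k : (n < k)%N -> Omega_entry n k = 0.
Proof. by rewrite /Omega_entry ltnNge => /negbTE ->. Qed.

Lemma Gamma_entry_eq0 n k : (n < k)%N -> Gamma_entry n k = 0.
Proof. by rewrite /Gamma_entry ltnNge => /negbTE ->. Qed.

Definition Omega : triangle := Triangle Omega_entry_eq0.
Definition Gamma : triangle := Triangle Gamma_entry_eq0.

Lemma transformE (A : triangle) x n :
  transform A x n = \sum_(k < n.+1) A n k * x k.
Proof.
apply/cvg_lim => //; apply: cvg_near_cst; exists n.+1 => // m /= lenm.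
rewrite /series /= (big_cat_nat (leq0n _) lenm) //= big_mkord -[RHS]addr0; congr (_ + _).
rewrite big_nat big1 // => k /andP[ltnk _].
by rewrite entry_eq0 ?mul0r.
Qed.

Lemma Omega_transformE x n :
  transform Omega x n = \sum_(k < n.+1) k.+1%:R * x k.
Proof.
by rewrite transformE; apply: eq_bigr => k _; rewrite /= /Omega_entry -ltnS ltn_ord.
Qed.

Lemma Gamma_transformE x n :
  transform Gamma x n = \sum_(k < n.+1) k.+1%:R^-1 * x k.
Proof.
by rewrite transformE; apply: eq_bigr => k _; rewrite /= /Gamma_entry -ltnS ltn_ord.
Qed.

Lemma transform_linear (A : triangle) a x y :
  transform A (a *: x + y) = a *: transform A x + transform A y.
Proof.
apply: (@funext nat K) => n; change (transform A (a *: x + y) n =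
  a * transform A x n + transform A y n).
rewrite !transformE mulr_sumr -big_split /=; apply: eq_bigr => k _.
by rewrite mulrDr mulrCA.
Qed.

Lemma transform0 (A : triangle) : transform A 0 = 0.
Proof.
by apply: (@funext nat K) => n; rewrite transformE big1 // => k _; rewrite mulr0.
Qed.

Definition seq_pred X : {pred nat -> K} := [pred x | `[< seq_space X x >]].

Definition domain_pred X A : {pred nat -> K} := [pred x | `[< seq_domain X A x >]].

Lemma seq_pred_submod X : GRing.submod_closed (seq_pred X).
Proof.
split=> [|a x y]; rewrite !unfold_in.
  case: X; apply/asboolP => /=.
  - by exists 0; split=> // M M0 k _; change (`|0 : K| <= M); rewrite normr0 ltW.
  - exact: is_cvg_cst.
  - exact: cvg_cst.
case: X => /asboolP /= xX /asboolP /= yX; apply/asboolP => /=.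
- have [M M0 xM] := pinfty_ex_gt0 xX; have [N N0 yN] := pinfty_ex_gt0 yX.
  exists (`|a| * M + N); split; first by rewrite realD ?realM ?normr_real ?gtr0_real.
  move=> P ltP k _; apply: le_trans (ltW ltP); apply: le_trans (ler_normD _ _) _.
  by rewrite lerD ?yN // normrZ ler_wpM2l ?xM.
- by apply: is_cvgD => //; exact: is_cvgZl_tmp.
- have := cvgD (cvgZl_tmp (V := K) xX : a \*: x @ \oo --> a *: (0 : K)) yX.
  by rewrite scaler0 addr0 => axy; exact: axy.
Qed.

Lemma domain_pred_submod X A : GRing.submod_closed (domain_pred X A).
Proof.
have [X0 XD] := seq_pred_submod X.
split=> [|a x y]; rewrite !unfold_in /= /seq_domain /=.
  by rewrite transform0; exact: X0.
by rewrite transform_linear; exact: XD.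
Qed.

HB.instance Definition _ X :=
  GRing.isSubmodClosed.Build K (nat -> K) (seq_pred X) (seq_pred_submod X).

HB.instance Definition _ X A :=
  GRing.isSubmodClosed.Build K (nat -> K) (domain_pred X A)
    (domain_pred_submod X A).

Record seqSpace X := SeqSpace {
  seqSpace_val :> nat -> K;
  seqSpace_valP : seqSpace_val \in seq_pred X }.

HB.instance Definition _ X := [isSub for @seqSpace_val X].
HB.instance Definition _ X := [Choice of seqSpace X by <:].
HB.instance Definition _ X := [SubChoice_isSubLmodule of seqSpace X by <:].

Record matrixDomain X A := MatrixDomain {
  matrixDomain_val :> nat -> K;
  matrixDomain_valP : matrixDomain_val \in domain_pred X A }.

HB.instance Definition _ X A := [isSub for @matrixDomain_val X A].
HB.instance Definition _ X A := [Choice of matrixDomain X A by <:].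
HB.instance Definition _ X A := [SubChoice_isSubLmodule of matrixDomain X A by <:].

Definition seqSpace_norm X (x : seqSpace X) : K := sup_norm x.

Definition matrixDomain_norm X A (x : matrixDomain X A) : K :=
  sup_norm (transform A x).

Definition is_norm (V : lmodType K) (N : V -> K) : Prop :=
  [/\ forall x y, N (x + y) <= N x + N y,
      forall a x, N (a *: x) = `|a| * N x
    & forall x, N x = 0 -> x = 0].

Definition norm_isomorphic (U V : lmodType K) (NU : U -> K) (NV : V -> K) : Prop :=
  exists T : {linear U -> V},
    (forall x, NV (T x) = NU x) /\ (forall y, exists x, T x = y).

End SequenceSpaces.

Arguments Omega {K}.
Arguments Gamma {K}.

(* Main.v *)
From HB Require Import structures.
Require Import Defs.
From mathcomp Require Import all_boot all_order all_algebra.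
From mathcomp Require Import complex.
From mathcomp Require Import all_classical all_reals all_analysis.

(* For a triangle A with nonzero diagonal, forward substitution solves
   A x = y for every y, and A x = 0 forces x = 0. So x |-> A x maps X(A)
   bijectively onto X, and it is isometric because the norm of X(A) is pulled
   back along it; hence X(A) is also normed as soon as X is. *)

Set Implicit Arguments.
Unset Strict Implicit.
Unset Printing Implicit Defensive.

Import Order.TTheory GRing.Theory Num.Theory.
Import numFieldNormedType.Exports.

Local Open Scope classical_set_scope.
Local Open Scope complex_scope.
Local Open Scope ring_scope.

(** In the partial order of [R[i]] a nonnegative element has zero imaginary part, so [E] lies on the
    real axis; the real supremum of the real parts, embedded back, is the least upper bound. *)
Lemma supremums_neq0_complex (R : realType) (E : set R[i]) :
  E !=set0 -> E `<=` [set z | 0 <= z] -> ubound E !=set0 ->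
  supremums E !=set0.
Proof.
move=> [z0 Ez0] E0 [u uE].
have realE (z : R[i]) : 0 <= z -> z = ((complex.Re z)%:C)%C.
  by case: z => a b; rewrite lecE /= => /andP[/eqP -> _].
have supE : has_sup ((fun z : R[i] => complex.Re z) @` E).
  split; first by exists (complex.Re z0), z0.
  by exists (complex.Re u) => _ [z Ez <-]; move: (uE _ Ez); rewrite lecE => /andP[].
exists ((sup ((fun z : R[i] => complex.Re z) @` E))%:C)%C; split.
  move=> z Ez; rewrite (realE z (E0 _ Ez)) lecE /= eqxx /=.
  by apply: ub_le_sup; [exact: supE.2 | exists z].
(* A competing bound [v] dominates the nonnegative [z0], hence is itself nonnegative and real. *)
move=> v vE; rewrite (realE v (le_trans (E0 _ Ez0) (vE _ Ez0))) lecE /= eqxx /=.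
apply: ge_sup; first exact: supE.1.
by move=> _ [z Ez <-]; move: (vE _ Ez); rewrite lecE => /andP[].
Qed.

(** This is where the order completeness of the scalars enters. *)
Lemma supremums_neq0 (R : realType) (K : numFieldType) (E : set K) :
  scalar_field R K -> E !=set0 -> E `<=` [set z | 0 <= z] ->
  ubound E !=set0 -> supremums E !=set0.
Proof.
move=> hK; case: hK E => E E0 Epos Eub; last exact: supremums_neq0_complex.
exists (sup E); split; first by move=> x Ex; exact: ub_le_sup.
by move=> v vE; exact: ge_sup.
Qed.

Section SupNorm.
Variables (R : realType) (K : numFieldType).
Hypothesis hK : scalar_field R K.
Implicit Types x y : nat -> K.

(** [supremum] picks some element of [supremums], with 0 as default; for a bounded sequence the
    choice is a genuine least upper bound, from which the norm axioms follow. *)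
Lemma sup_norm_supremums x : bounded_fun x ->
  supremums (range (fun k => `|x k|)) (sup_norm x).
Proof.
move=> bx; have [M _ xM] := pinfty_ex_gt0 bx.
have [| | |s xs] := @supremums_neq0 R K (range (fun k => `|x k|)) hK.
- by exists `|x 0%N|, 0%N.
- by move=> _ [k _ <-]; exact: normr_ge0.
- by exists M => _ [k _ <-]; exact: xM.
rewrite /sup_norm /supremum; case: eqP => [e|_].
  by have : set0 `|x 0%N| by rewrite -e; exists 0%N.
exact: xgetI xs.
Qed.

Lemma ler_sup_norm x k : bounded_fun x -> `|x k| <= sup_norm x.
Proof. by move=> /sup_norm_supremums[+ _]; apply; exists k. Qed.

Lemma sup_norm_le x M : bounded_fun x -> (forall k, `|x k| <= M) ->
  sup_norm x <= M.
Proof. by move=> /sup_norm_supremums[_ +] xM; apply => _ [k _ <-]. Qed.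

Lemma sup_norm_ge0 x : bounded_fun x -> 0 <= sup_norm x.
Proof. by move=> /(ler_sup_norm 0); exact: le_trans. Qed.

Lemma sup_normD x y : bounded_fun x -> bounded_fun y ->
  bounded_fun (x + y) -> sup_norm (x + y) <= sup_norm x + sup_norm y.
Proof.
move=> bx by_ bxy; apply: sup_norm_le => // k.
by apply: le_trans (ler_normD _ _) _; rewrite lerD ?ler_sup_norm.
Qed.

Lemma sup_normZ a x : bounded_fun x -> bounded_fun (a *: x) ->
  sup_norm (a *: x) = `|a| * sup_norm x.
Proof.
move=> bx bax; apply/eqP; rewrite eq_le; apply/andP; split.
  by apply: sup_norm_le => // k; rewrite normrM ler_wpM2l ?ler_sup_norm.
(* For the reverse inequality with [a] nonzero, dividing by its modulus shows that
   [sup_norm (a *: x) / |a|] bounds every [|x k|]. *)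
have [a0|a0] := eqVneq a 0.
  by rewrite {1}a0 normr0 mul0r; exact: sup_norm_ge0.
rewrite mulrC -ler_pdivlMr ?normr_gt0 //; apply: sup_norm_le => // k.
by rewrite ler_pdivlMr ?normr_gt0 // mulrC -normrM; exact: ler_sup_norm.
Qed.

Lemma sup_norm_eq0 x : bounded_fun x -> sup_norm x = 0 -> x = 0.
Proof.
move=> bx x0; apply: (@funext nat K) => k; apply/eqP.
by rewrite -normr_le0 -x0 ler_sup_norm.
Qed.

Lemma seq_space_bounded (X : classical_space) x :
  seq_space X x -> bounded_fun x.
Proof.
case: X => //= xX; apply: cvg_seq_bounded => //; apply/cvg_ex; by exists 0.
Qed.

Lemma is_norm_seqSpace (X : classical_space) : is_norm (@seqSpace_norm K X).
Proof.
have bnd (x : seqSpace K X) : bounded_fun (seqSpace_val x).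
  by apply: (@seq_space_bounded X); exact/asboolP/(seqSpace_valP x).
split=> [x y|a x|x x0].
- exact: sup_normD (bnd x) (bnd y) (bnd (x + y)).
- exact: sup_normZ (bnd x) (bnd (a *: x)).
- by apply: val_inj; exact: sup_norm_eq0 (bnd x) x0.
Qed.

End SupNorm.

Section TriangleTransform.
Variables (K : numFieldType) (A : triangle K).
Hypothesis diagA : forall n, A n n != 0.

(** By strong induction: once the earlier entries vanish, row [n] reduces to [A n n * x n = 0]. *)
Lemma transform_eq0 x : transform A x = 0 -> x = 0.
Proof.
move=> Ax0; apply: (@funext nat K) => n.
elim/ltn_ind: n => n IHn; have /eqP := congr1 (@^~ n) Ax0.
rewrite transformE big_ord_recr /= big1 ?add0r => [|k _]; last first.
  by rewrite IHn ?mulr0.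
by rewrite mulf_eq0 (negbTE (diagA n)) => /eqP.
Qed.

(** Returns the first [n] entries of the solution as a list, so that structural recursion gives
    access to all earlier entries at once. *)
Fixpoint forward_substitution (y : nat -> K) n : seq K :=
  if n is m.+1 then
    let s := forward_substitution y m in
    rcons s ((y m - \sum_(k < m) A m k * s`_k) / A m m)
  else [::].

Lemma size_forward_substitution y n : size (forward_substitution y n) = n.
Proof. by elim: n => //= n IHn; rewrite size_rcons IHn. Qed.

(** Each stage only appends, so entries already computed never change. *)
Lemma nth_forward_substitution y n k : (k < n)%N ->
  (forward_substitution y n)`_k = (forward_substitution y k.+1)`_k.
Proof.
elim: n => // n IHn; rewrite ltnS leq_eqVlt => /predU1P[->//|ltkn].
by rewrite [LHS]nth_rcons size_forward_substitution ltkn IHn.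
Qed.

Lemma transform_surj y : exists x, transform A x = y.
Proof.
exists (fun k => (forward_substitution y k.+1)`_k).
apply: (@funext nat K) => n; rewrite transformE big_ord_recr /=.
rewrite nth_rcons size_forward_substitution ltnn eqxx mulrC divfK //.
(* The diagonal term has become [y n] minus a sum over the stage-[n] list; by stability of the
   entries that sum cancels the off-diagonal part of row [n]. *)
rewrite addrC -addrA -[RHS]addr0; congr (_ + _); apply/eqP.
rewrite addrC subr_eq0; apply/eqP; apply: eq_bigr => k _.
by rewrite (nth_forward_substitution _ (ltn_ord k)).
Qed.

Variable X : classical_space.

(** Membership of [x] in X(A) unfolds to membership of [transform A x] in X, so the same proof term
    serves for both. *)
Definition domain_transform (x : matrixDomain X A) : seqSpace K X :=
  SeqSpace (matrixDomain_valP x).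

Lemma domain_transform_is_linear : linear domain_transform.
Proof. by move=> a x y; apply: val_inj; exact: transform_linear. Qed.

HB.instance Definition _ := GRing.isLinear.Build K (matrixDomain X A)
  (seqSpace K X) _ domain_transform domain_transform_is_linear.

Lemma norm_isomorphic_matrixDomain :
  norm_isomorphic (@matrixDomain_norm K X A) (@seqSpace_norm K X).
Proof.
(* The isometry holds by conversion: both norms unfold to [sup_norm (transform A x)]. *)
exists domain_transform; split=> // y.
have [x Axy] := transform_surj (seqSpace_val y).
have xX : x \in domain_pred X A.
  have := seqSpace_valP y; rewrite !unfold_in => /asboolP yX.
  by apply/asboolP; rewrite /seq_domain /= Axy.
by exists (MatrixDomain xX); apply: val_inj.
Qed.

Lemma is_norm_matrixDomain :
  is_norm (@seqSpace_norm K X) -> is_norm (@matrixDomain_norm K X A).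
Proof.
move=> [normD normZ norm0]; split=> [x y|a x|x x0].
- by have := normD (domain_transform x) (domain_transform y); rewrite -linearD.
- by have := normZ a (domain_transform x); rewrite -linearZ.
(* Definiteness is the axiom that needs injectivity of the transform. *)
- apply: val_inj; apply: transform_eq0.
  by have /(congr1 (@seqSpace_val K X)) := norm0 (domain_transform x) x0.
Qed.

End TriangleTransform.

Lemma Omega_diag_neq0 (K : numFieldType) n : (@Omega K) n n != 0.
Proof. by rewrite /= /Omega_entry leqnn pnatr_eq0. Qed.

Lemma Gamma_diag_neq0 (K : numFieldType) n : (@Gamma K) n n != 0.
Proof. by rewrite /= /Gamma_entry leqnn invr_eq0 pnatr_eq0. Qed.

Theorem theorem2p1 (R : realType) (K : numFieldType) (hK : scalar_field R K)
    (X : classical_space) :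
  [/\ is_norm (@seqSpace_norm K X),
      is_norm (@matrixDomain_norm K X Omega),
      is_norm (@matrixDomain_norm K X Gamma),
      norm_isomorphic (@matrixDomain_norm K X Omega) (@seqSpace_norm K X)
    & norm_isomorphic (@matrixDomain_norm K X Gamma) (@seqSpace_norm K X)].
Proof.
have seq_norm := is_norm_seqSpace hK X.
split=> //.
- exact: is_norm_matrixDomain (@Omega_diag_neq0 K) X seq_norm.
- exact: is_norm_matrixDomain (@Gamma_diag_neq0 K) X seq_norm.
- exact: norm_isomorphic_matrixDomain (@Omega_diag_neq0 K) X.
- exact: norm_isomorphic_matrixDomain (@Gamma_diag_neq0 K) X.
Qed.
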